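(* Let $H$ and $A$ be weak Hopf algebras over $\Bbbk$ and let $(H,A)$ be a compatible weak matched pair. If $\alpha\in\int_\ell^A$, then $h\cdot\alpha\in\int_\ell^A$ for all $h\in H$.
   Context: Everything is over a fixed field $\Bbbk$, $\otimes=\otimes_\Bbbk$; algebras are associative and unital, coalgebras coassociative and counital; Sweedler notation $\Delta(h)=h_1\otimes h_2$ (summation understood). A weak bialgebra $H$ is an algebra and a coalgebra such that $\Delta(hk)=\Delta(h)\Delta(k)$; $\varepsilon(hk\ell)=\varepsilon(hk_1)\varepsilon(k_2\ell)=\varepsilon(hk_2)\varepsilon(k_1\ell)$; and $(1_H\otimes\Delta(1_H))(\Delta(1_H)\otimes 1_H)=(\Delta(1_H)\otimes 1_H)(1_H\otimes\Delta(1_H))=\Delta^2(1_H)$, where $\Delta^2=(\Delta\otimes \mathrm{id})\Delta$. Write $\Delta(1_H)=1_{H1}\otimes 1_{H2}$; primes denote further copies. Put $\varepsilon_t(h)=\varepsilon(1_{H1}h)1_{H2}$ and $\varepsilon_s(h)=1_{H1}\varepsilon(h1_{H2})$ (similarly for $A$). A weak Hopf algebra is a weak bialgebra with a linear map $S:H\to H$ (antipode) with $h_1S(h_2)=\varepsilon_t(h)$, $S(h_1)h_2=\varepsilon_s(h)$, $S(h_1)h_2S(h_3)=S(h)$. A left integral in a weak Hopf algebra $H$ is an element $\alpha\in H$ with $h\alpha=\varepsilon_t(h)\alpha$ for all $h\in H$; $\int_\ell^H$ denotes the space of left integrals in $H$. For a weak bialgebra $H$ and an algebra $A$, $A$ is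 a left $H$-module algebra if there is a linear map $\cdot:H\otimes A\to A$ with $1_H\cdot a=a$; $h\cdot ab=(h_1\cdot a)(h_2\cdot b)$; $h\cdot(k\cdot a)=hk\cdot a$; $h\cdot 1_A=\varepsilon_t(h)\cdot 1_A$. For a weak bialgebra $A$ and a coalgebra $H$, $H$ is a right $A$-comodule coalgebra if there is a linear map $\rho:H\to H\otimes A$, $\rho(h)=h^0\otimes h^1$, with $\varepsilon(h^1)h^0=h$; ${h^0}_1\otimes{h^0}_2\otimes h^1={h_1}^0\otimes{h_2}^0\otimes{h_1}^1{h_2}^1$; $h^{00}\otimes h^{01}\otimes h^1=h^0\otimes{h^1}_1\otimes{h^1}_2$; $h^1\varepsilon(h^0)=\varepsilon_s(h^1)\varepsilon(h^0)$. Here $h^{00}\otimes h^{01}\otimes h^1=(\rho\otimes\mathrm{id})\rho(h)$, ${h_1}^0\otimes {h_1}^1$ is $\rho$ applied to the leg $h_1$, and ${h^0}_1\otimes{h^0}_2$ is $\Delta$ applied to the leg $h^0$. A pair $(H,A)$ of weak bialgebras is a weak matched pair if: (i) $A$ is a left $H$-module algebra via $\cdot$; (ii) $H$ is a right $A$-comodule coalgebra via $\rho$; (iii) $(h_2g)^0\otimes(h_1\cdot x)_1\otimes(h_1\cdot x)_2(h_2g)^1={h_3}^0g^0\otimes({h_1}^0\cdot x_1)\otimes{h_1}^1(h_2\cdot x_2){h_3}^1(h_4\cdot g^1)$; (iv) $\varepsilon_s(h\cdot x)=\varepsilon_s(h\cdot 1_A)\varepsilon_s(x)$; (v) $\rho(1_{H1})\otimes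 1_{H2}=1_{H1}\otimes\varepsilon({1_{H1}'}^0){1_{H1}'}^1\otimes 1_{H2}1_{H2}'$; for all $h,g\in H$, $x\in A$. It is abelian if $H$ is cocommutative and $A$ is commutative. A compatible weak matched pair is an abelian weak matched pair such that, for all $h,g\in H$: $h\cdot 1_A=h_1\cdot 1_{A1}\,\varepsilon(h_2\cdot 1_{A2})$ and $h\cdot 1_{A1}\otimes g\cdot 1_{A2}=(h\cdot 1_A)1_{A1}\otimes(g\cdot 1_A)1_{A2}$. *)

(* Defs.v *)
From HB Require Import structures.
From mathcomp Require Import all_boot all_order all_algebra.
From mathcomp Require Import boolp.

Set Implicit Arguments.
Unset Strict Implicit.
Unset Printing Implicit Defensive.

Import GRing.Theory.

Local Open Scope ring_scope.
Local Open Scope quotient_scope.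

Reserved Notation "v \ox w" (at level 40, left associativity).
Reserved Notation "\tsum_ ( x \ox y <- t ) E"
  (at level 41, right associativity, x name, y name, t at level 200,
   E at level 41, format "'[' \tsum_ ( x  \ox  y  <-  t ) '/  '  E ']'").

(** * Tensor product of two K-modules

    [tensor V W] is the quotient of the formal sums [v_1 (x) w_1 + ... + v_n (x)
    w_n], encoded as [seq (V * W)], by the congruence generated by
    commutativity, biadditivity and balancedness.  No formal coefficients are
    needed, because a scalar can be absorbed in the left factor; the rule
    [tensor_eq0] identifies [0 (x) w] with the empty sum, which does not
    follow from the other rules, since a commutative monoid need not be
    cancellative. *)

Section TensorRelation.
Context {K : fieldType} {V W : lmodType K}.

Inductive tensor_eq : seq (V * W) -> seq (V * W) -> Prop :=
| tensor_eq_refl s : tensor_eq s s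
| tensor_eq_sym s t : tensor_eq s t -> tensor_eq t s
| tensor_eq_trans s t u : tensor_eq s t -> tensor_eq t u -> tensor_eq s u
| tensor_eq_cat s s' t t' :
    tensor_eq s s' -> tensor_eq t t' -> tensor_eq (s ++ t) (s' ++ t')
| tensor_eq_comm s t : tensor_eq (s ++ t) (t ++ s)
| tensor_eqDl v v' w : tensor_eq [:: (v + v', w)] [:: (v, w); (v', w)]
| tensor_eqDr v w w' : tensor_eq [:: (v, w + w')] [:: (v, w); (v, w')]
| tensor_eqZ a v w : tensor_eq [:: (a *: v, w)] [:: (v, a *: w)]
| tensor_eq0 w : tensor_eq [:: (0, w)] [::].

Definition tensor_rel (s t : seq (V * W)) : bool := `[< tensor_eq s t >].

Fact tensor_rel_refl : reflexive tensor_rel.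
Proof. by move=> s; apply/asboolP; exact: tensor_eq_refl. Qed.

Fact tensor_rel_sym : symmetric tensor_rel.
Proof. by move=> s t; apply/asboolP/asboolP; exact: tensor_eq_sym. Qed.

Fact tensor_rel_trans : transitive tensor_rel.
Proof.
move=> t s u /asboolP st /asboolP tu; apply/asboolP.
exact: tensor_eq_trans st tu.
Qed.

Canonical tensor_equiv :=
  EquivRel tensor_rel tensor_rel_refl tensor_rel_sym tensor_rel_trans.

Lemma tensor_eq_map (g : V -> V) :
    {morph g : x y / x + y} -> (forall a, {morph g : x / a *: x}) ->
  forall s t, tensor_eq s t ->
    tensor_eq [seq (g p.1, p.2) | p <- s] [seq (g p.1, p.2) | p <- t].
Proof.
move=> gD gZ s t; elim => {s t} /=.
- by move=> s; exact: tensor_eq_refl.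
- by move=> s t _; exact: tensor_eq_sym.
- by move=> s t u _ st _; exact: tensor_eq_trans st.
- by move=> s s' t t' _ ss' _ tt'; rewrite !map_cat; exact: tensor_eq_cat.
- by move=> s t; rewrite !map_cat; exact: tensor_eq_comm.
- by move=> v v' w; rewrite gD; exact: tensor_eqDl.
- by move=> v w w'; exact: tensor_eqDr.
- by move=> a v w; rewrite gZ; exact: tensor_eqZ.
- by move=> w; rewrite -(scale0r (0 : V)) gZ scale0r; exact: tensor_eq0.
Qed.

Lemma tensor_eq_mapN s : tensor_eq ([seq (- p.1, p.2) | p <- s] ++ s) [::].
Proof.
elim: s => [|[v w] s IH] /=; first exact: tensor_eq_refl.
have -> : (- v, w) :: [seq (- p.1, p.2) | p <- s] ++ (v, w) :: s =
  [:: (- v, w)] ++ ([seq (- p.1, p.2) | p <- s] ++ ([:: (v, w)] ++ s)) by [].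
apply: (@tensor_eq_trans _
  ([:: (- v, w)] ++ (([seq (- p.1, p.2) | p <- s] ++ s) ++ [:: (v, w)]))).
  apply: tensor_eq_cat; first exact: tensor_eq_refl.
  rewrite -catA; apply: tensor_eq_cat; first exact: tensor_eq_refl.
  exact: tensor_eq_comm.
apply: (@tensor_eq_trans _ ([:: (- v, w)] ++ ([::] ++ [:: (v, w)]))).
  apply: tensor_eq_cat; first exact: tensor_eq_refl.
  by apply: tensor_eq_cat => //; exact: tensor_eq_refl.
apply: (@tensor_eq_trans _ [:: (- v + v, w)]).
  by apply: tensor_eq_sym; exact: tensor_eqDl.
by rewrite addNr; exact: tensor_eq0.
Qed.

Lemma tensor_eq_scaleD a b s :
  tensor_eq [seq ((a + b) *: p.1, p.2) | p <- s]
    ([seq (a *: p.1, p.2) | p <- s] ++ [seq (b *: p.1, p.2) | p <- s]).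
Proof.
elim: s => [|[v w] s IH] /=; first exact: tensor_eq_refl.
rewrite scalerDl; set sa := map _ s; set sb := map _ s; set sc := map _ s.
apply: (@tensor_eq_trans _ ([:: (a *: v, w); (b *: v, w)] ++ (sb ++ sc))).
  by apply: (@tensor_eq_cat [:: _]) => //; exact: tensor_eqDl.
apply: (@tensor_eq_cat [:: _] [:: _]); first exact: tensor_eq_refl.
rewrite -cat1s [X in tensor_eq _ X](_ : _ = sb ++ [:: (b *: v, w)] ++ sc) //.
rewrite !catA; apply: tensor_eq_cat; last exact: tensor_eq_refl.
exact: tensor_eq_comm.
Qed.

(* A biadditive balanced map is constant on the classes of [tensor_eq]. *)
Lemma tensor_eq_sum (U : lmodType K) (f : V -> W -> U) :
    (forall w, linear (f^~ w)) -> (forall v, linear (f v)) ->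
  forall s t, tensor_eq s t ->
    \sum_(p <- s) f p.1 p.2 = \sum_(p <- t) f p.1 p.2.
Proof.
move=> fl fr s t; elim => {s t} //=.
- by move=> s t u _ -> _ ->.
- by move=> s s' t t' _ ss' _ tt'; rewrite !big_cat ss' tt'.
- by move=> s t; rewrite !big_cat /= addrC.
- move=> v v' w; rewrite !big_cons !big_nil /= !addr0.
  by have := fl w 1 v v'; rewrite !scale1r.
- move=> v w w'; rewrite !big_cons !big_nil /= !addr0.
  by have := fr v 1 w w'; rewrite !scale1r.
- have f0l w : f 0 w = 0.
    by apply: (@addrI _ (f 0 w)); have := fl w 1 0 0; rewrite !scale1r !addr0.
  have f0r v : f v 0 = 0.
    by apply: (@addrI _ (f v 0)); have := fr v 1 0 0; rewrite !scale1r !addr0.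
  move=> a v w; rewrite !big_cons !big_nil /= !addr0.
  have := fl w a v 0; rewrite addr0 f0l addr0 => ->.
  by have := fr v a w 0; rewrite addr0 f0r addr0 => ->.
- move=> w; rewrite big_cons !big_nil addr0 /=.
  by apply: (@addrI _ (f 0 w)); have := fl w 1 0 0; rewrite !scale1r !addr0.
Qed.

End TensorRelation.

Definition tensor (K : fieldType) (V W : lmodType K) : Type :=
  {eq_quot (@tensor_equiv K V W)}.

Notation "V \ox W" := (tensor V W) : type_scope.

Section TensorModule.
Context {K : fieldType} {V W : lmodType K}.
Local Notation T := (tensor V W).

HB.instance Definition _ := Choice.on T.
HB.instance Definition _ : EqQuotient _ _ T :=
  EqQuotient.on T.

Implicit Types (s t : seq (V * W)) (x y z : T).

Definition tensor_class s : T := \pi_T s.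

Fact tensor_classP s t : tensor_eq s t -> tensor_class s = tensor_class t.
Proof. by move=> st; apply/eqquotP; apply/asboolP. Qed.

Fact tensor_reprP s : tensor_eq (repr (tensor_class s)) s.
Proof.
apply/asboolP; have /eqquotP := reprK (tensor_class s).
by rewrite /tensor_class.
Qed.

Fact tensor_classK x : tensor_class (repr x) = x.
Proof. exact: reprK. Qed.

Definition tensor_add x y : T := tensor_class (repr x ++ repr y).
Definition tensor_zero : T := tensor_class [::].
Definition tensor_opp x : T := tensor_class [seq (- p.1, p.2) | p <- repr x].
Definition tensor_scale (a : K) x : T :=
  tensor_class [seq (a *: p.1, p.2) | p <- repr x].

Fact tensor_addE s t :
  tensor_add (tensor_class s) (tensor_class t) = tensor_class (s ++ t).
Proof. by apply: tensor_classP; apply: tensor_eq_cat; exact: tensor_reprP. Qed.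

Fact tensor_scaleE a s : tensor_scale a (tensor_class s) =
  tensor_class [seq (a *: p.1, p.2) | p <- s].
Proof.
apply: tensor_classP; apply: (@tensor_eq_map _ _ _ ( *:%R a)).
- exact: scalerDr.
- by move=> b v; rewrite !scalerA mulrC.
- exact: tensor_reprP.
Qed.

Fact tensor_addA : associative tensor_add.
Proof.
move=> x y z; rewrite -(tensor_classK x) -(tensor_classK y) -(tensor_classK z).
by rewrite !tensor_addE catA.
Qed.

Fact tensor_addC : commutative tensor_add.
Proof. by move=> x y; apply: tensor_classP; exact: tensor_eq_comm. Qed.

Fact tensor_add0 : left_id tensor_zero tensor_add.
Proof. by move=> x; rewrite -(tensor_classK x) tensor_addE. Qed.

Fact tensor_addN : left_inverse tensor_zero tensor_opp tensor_add.
Proof.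
move=> x; rewrite -{2}(tensor_classK x) tensor_addE.
by apply: tensor_classP; exact: tensor_eq_mapN.
Qed.

HB.instance Definition _ :=
  GRing.isZmodule.Build T tensor_addA tensor_addC tensor_add0 tensor_addN.

Fact tensor_scaleA a b x :
  tensor_scale a (tensor_scale b x) = tensor_scale (a * b) x.
Proof.
rewrite -(tensor_classK x) !tensor_scaleE -map_comp.
by congr tensor_class; apply: eq_map => p /=; rewrite scalerA.
Qed.

Fact tensor_scale1 : left_id 1 tensor_scale.
Proof.
move=> x; rewrite -(tensor_classK x) tensor_scaleE; congr tensor_class.
by rewrite -[RHS]map_id; apply: eq_map => -[v w] /=; rewrite scale1r.
Qed.

Fact tensor_scaleDr : right_distributive tensor_scale +%R.
Proof.
move=> a x y; rewrite -(tensor_classK x) -(tensor_classK y).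
by rewrite [_ + _]tensor_addE !tensor_scaleE [RHS]tensor_addE map_cat.
Qed.

Fact tensor_scaleDl x : {morph tensor_scale^~ x : a b / a + b}.
Proof.
move=> a b; rewrite -(tensor_classK x) !tensor_scaleE [RHS]tensor_addE.
by apply: tensor_classP; exact: tensor_eq_scaleD.
Qed.

HB.instance Definition _ := GRing.Zmodule_isLmodule.Build K T
  tensor_scaleA tensor_scale1 tensor_scaleDr tensor_scaleDl.

Definition tens (v : V) (w : W) : T := tensor_class [:: (v, w)].

(* Sweedler-type sums: [\tsum_(x \ox y <- t) E x y] evaluates [E] on a chosen
   decomposition of [t] into pure tensors.  For [E] bilinear, it is the value
   at [t] of the linear map on [V \ox W] that [E] induces, so that the choice
   is irrelevant: see [tsum_class], [tsum_tens] and [tsum_linear]. *)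
Definition tsum (U : nmodType) (t : T) (E : V -> W -> U) : U :=
  \sum_(p <- repr t) E p.1 p.2.

End TensorModule.

Notation "v \ox w" := (tens v w) : ring_scope.
Notation "\tsum_ ( x \ox y <- t ) E" := (tsum t (fun x y => E)) : ring_scope.

Section TensorTheory.
Context {K : fieldType} {V W : lmodType K}.

Lemma tens_linearl (w : W) : linear (fun v : V => v \ox w).
Proof.
move=> a v v'; rewrite [X in _ = X + _]tensor_scaleE [RHS]tensor_addE /=.
by apply: tensor_classP; exact: tensor_eqDl.
Qed.

Lemma tens_linearr (v : V) : linear (fun w : W => v \ox w).
Proof.
move=> a w w'; rewrite [X in _ = X + _]tensor_scaleE [RHS]tensor_addE /=.
apply: tensor_classP; apply: tensor_eq_trans (tensor_eqDr _ _ _) _.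
apply: (@tensor_eq_cat _ _ _ [:: _] [:: _]); last exact: tensor_eq_refl.
by apply: tensor_eq_sym; exact: tensor_eqZ.
Qed.

Lemma tens_decomp (t : V \ox W) : t = \tsum_(v \ox w <- t) (v \ox w).
Proof.
rewrite -{1}(tensor_classK t) /tsum; elim: (repr t) => [|[v w] s IH].
  by rewrite big_nil.
by rewrite big_cons -IH [RHS]tensor_addE.
Qed.

Variables (U : lmodType K) (E : V -> W -> U).
Hypotheses (El : forall w, linear (E^~ w)) (Er : forall v, linear (E v)).

Lemma tsum_class s :
  \tsum_(x \ox y <- tensor_class s) E x y = \sum_(p <- s) E p.1 p.2.
Proof. by apply: tensor_eq_sum => //; exact: tensor_reprP. Qed.

Lemma tsum_tens v w : \tsum_(x \ox y <- v \ox w) E x y = E v w.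
Proof. by rewrite tsum_class big_seq1. Qed.

Lemma tsum_linear : linear (fun t : V \ox W => \tsum_(x \ox y <- t) E x y).
Proof.
move=> a s t; rewrite -(tensor_classK s) -(tensor_classK t).
rewrite [X in tsum (X + _)]tensor_scaleE [_ + _]tensor_addE !tsum_class big_cat /= big_map.
congr (_ + _); rewrite scaler_sumr; apply: eq_bigr => p _ /=.
have E0 : E 0 p.2 = 0.
  apply: (@addrI _ (E 0 p.2)).
  by have := El p.2 1 0 0; rewrite !scale1r !addr0.
by have := El p.2 a p.1 0; rewrite !addr0 E0 addr0.
Qed.

End TensorTheory.

(** * Algebras and coalgebras *)

(* Associative unital K-algebras, the zero algebra included: the library's
   [algType] would impose [1 != 0]. *)
Record algebraType (K : fieldType) := AlgebraType {
  alg_ring : pzRingType;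
  alg_scale : K -> alg_ring -> alg_ring;
  alg_scaleA : forall a b x, alg_scale a (alg_scale b x) = alg_scale (a * b) x;
  alg_scale1 : left_id 1 alg_scale;
  alg_scaleDr : right_distributive alg_scale +%R;
  alg_scaleDl : forall x, {morph alg_scale^~ x : a b / a + b};
  alg_scaleAl : forall a x y, alg_scale a (x * y) = alg_scale a x * y;
  alg_scaleAr : forall a x y, alg_scale a (x * y) = x * alg_scale a y
}.

Definition alg_carrier (K : fieldType) (A : algebraType K) : Type := alg_ring A.
Coercion alg_carrier : algebraType >-> Sortclass.

Section AlgebraInstances.
Context {K : fieldType} (A : algebraType K).

HB.instance Definition _ := GRing.PzRing.copy (alg_carrier A) (alg_ring A).
HB.instance Definition _ := GRing.Zmodule_isLmodule.Build K (alg_carrier A)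
  (@alg_scaleA K A) (@alg_scale1 K A) (@alg_scaleDr K A) (@alg_scaleDl K A).

Definition alg_lmodType : lmodType K := alg_carrier A.

Lemma alg_scalerAl (a : K) (x y : A) : a *: (x * y) = (a *: x) * y.
Proof. exact: alg_scaleAl. Qed.

Lemma alg_scalerAr (a : K) (x y : A) : a *: (x * y) = x * (a *: y).
Proof. exact: alg_scaleAr. Qed.

End AlgebraInstances.

Coercion alg_lmodType : algebraType >-> GRing.Lmodule.type.

Record coalgebra (K : fieldType) (C : lmodType K) := Coalgebra {
  coalg_comul : {linear C -> (C \ox C)%type};
  coalg_counit : {scalar C};
  coalg_comulA : forall h : C,
    \tsum_(x \ox h3 <- coalg_comul h) \tsum_(h1 \ox h2 <- coalg_comul x)
      (h1 \ox h2 \ox h3)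
    = \tsum_(h1 \ox x <- coalg_comul h) \tsum_(h2 \ox h3 <- coalg_comul x)
      (h1 \ox h2 \ox h3);
  coalg_counitl : forall h : C,
    \tsum_(h1 \ox h2 <- coalg_comul h) (coalg_counit h1 *: h2) = h;
  coalg_counitr : forall h : C,
    \tsum_(h1 \ox h2 <- coalg_comul h) (coalg_counit h2 *: h1) = h
}.

(** * Weak bialgebras and weak Hopf algebras *)

(* [wb_comul1l] and [wb_comul1r] have [comul^2 1 = (comul \ox id) (comul 1)] as
   right-hand side; their left-hand sides are [(1 \ox comul 1) (comul 1 \ox 1)]
   and [(comul 1 \ox 1) (1 \ox comul 1)], multiplied factorwise. *)
Record weakBialgType (K : fieldType) := WeakBialgType {
  wb_alg :> algebraType K;
  wb_coalg : coalgebra wb_alg;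
  wb_comulM : forall h k : wb_alg,
    coalg_comul wb_coalg (h * k) =
      \tsum_(h1 \ox h2 <- coalg_comul wb_coalg h)
      \tsum_(k1 \ox k2 <- coalg_comul wb_coalg k) ((h1 * k1) \ox (h2 * k2));
  wb_counitM12 : forall h k l : wb_alg,
    coalg_counit wb_coalg (h * k * l) =
      \tsum_(k1 \ox k2 <- coalg_comul wb_coalg k)
        (coalg_counit wb_coalg (h * k1) * coalg_counit wb_coalg (k2 * l));
  wb_counitM21 : forall h k l : wb_alg,
    coalg_counit wb_coalg (h * k * l) =
      \tsum_(k1 \ox k2 <- coalg_comul wb_coalg k)
        (coalg_counit wb_coalg (h * k2) * coalg_counit wb_coalg (k1 * l));
  wb_comul1l :
    \tsum_(y1 \ox y2 <- coalg_comul wb_coalg 1)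
    \tsum_(x1 \ox x2 <- coalg_comul wb_coalg 1)
      ((1 * x1) \ox (y1 * x2) \ox (y2 * 1))
    = \tsum_(x \ox x3 <- coalg_comul wb_coalg 1)
      \tsum_(x1 \ox x2 <- coalg_comul wb_coalg x) (x1 \ox x2 \ox x3);
  wb_comul1r :
    \tsum_(x1 \ox x2 <- coalg_comul wb_coalg 1)
    \tsum_(y1 \ox y2 <- coalg_comul wb_coalg 1)
      ((x1 * 1) \ox (x2 * y1) \ox (1 * y2))
    = \tsum_(x \ox x3 <- coalg_comul wb_coalg 1)
      \tsum_(x1 \ox x2 <- coalg_comul wb_coalg x) (x1 \ox x2 \ox x3)
}.

Section WeakBialgebra.
Context {K : fieldType} {H : weakBialgType K}.

Definition comul : {linear H -> (H \ox H)%type} := coalg_comul (wb_coalg H).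
Definition counit : {scalar H} := coalg_counit (wb_coalg H).

Definition counit_t (h : H) : H :=
  \tsum_(e1 \ox e2 <- comul 1) (counit (e1 * h) *: e2).

Definition counit_s (h : H) : H :=
  \tsum_(e1 \ox e2 <- comul 1) (counit (h * e2) *: e1).

End WeakBialgebra.

Record weakHopfType (K : fieldType) := WeakHopfType {
  wh_weakBialg :> weakBialgType K;
  antipode : {linear wh_weakBialg -> wh_weakBialg};
  antipode_t : forall h : wh_weakBialg,
    \tsum_(h1 \ox h2 <- comul h) (h1 * antipode h2) = counit_t h;
  antipode_s : forall h : wh_weakBialg,
    \tsum_(h1 \ox h2 <- comul h) (antipode h1 * h2) = counit_s h;
  antipodeE : forall h : wh_weakBialg,
    \tsum_(x \ox h3 <- comul h) \tsum_(h1 \ox h2 <- comul x)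
      (antipode h1 * h2 * antipode h3) = antipode h
}.

Definition left_integral (K : fieldType) (H : weakHopfType K) (alpha : H) :
  Prop := forall h : H, h * alpha = counit_t h * alpha.

(** * Weak matched pairs *)

Section ModuleAlgebra.
Context {K : fieldType} {H : weakBialgType K} {A : algebraType K}.
Variable act : {linear (H \ox A)%type -> A}.
Local Notation "h |> a" := (act (@tens K H A h a)) (at level 35).

Record left_module_algebra : Prop := LeftModuleAlgebra {
  act1 : forall a : A, 1 |> a = a;
  actM : forall (h : H) (a b : A),
    h |> (a * b) = \tsum_(h1 \ox h2 <- comul h) ((h1 |> a) * (h2 |> b));
  actA : forall (h k : H) (a : A), h |> (k |> a) = (h * k) |> a;
  act_unit : forall h : H, h |> 1 = counit_t h |> 1
}.

End ModuleAlgebra.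

Section ComoduleCoalgebra.
Context {K : fieldType} {A : weakBialgType K} {H : lmodType K}.
Variables (C : coalgebra H) (rho : {linear H -> (H \ox A)%type}).

Record right_comodule_coalgebra : Prop := RightComoduleCoalgebra {
  coact_counit : forall h : H,
    \tsum_(h0 \ox h1 <- rho h) (counit h1 *: h0) = h;
  coact_comul : forall h : H,
    \tsum_(h0 \ox a <- rho h) \tsum_(u \ox v <- coalg_comul C h0) (u \ox v \ox a)
    = \tsum_(h1 \ox h2 <- coalg_comul C h)
      \tsum_(u \ox a <- rho h1) \tsum_(v \ox b <- rho h2)
        (u \ox v \ox (a * b));
  coactA : forall h : H,
    \tsum_(h0 \ox b <- rho h) \tsum_(u \ox a <- rho h0) (u \ox a \ox b)
    = \tsum_(h0 \ox h1 <- rho h) \tsum_(a \ox b <- comul h1) (h0 \ox a \ox b);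
  coact_counit_s : forall h : H,
    \tsum_(h0 \ox h1 <- rho h) (coalg_counit C h0 *: h1)
    = \tsum_(h0 \ox h1 <- rho h) (coalg_counit C h0 *: counit_s h1)
}.

End ComoduleCoalgebra.

Section MatchedPair.
Context {K : fieldType} {H A : weakBialgType K}.
Variables (act : {linear (H \ox A)%type -> A}) (rho : {linear H -> (H \ox A)%type}).
Local Notation "h |> a" := (act (@tens K H A h a)) (at level 35).

(* In [wmp_compat], [hi0 \ox hi1] is [rho] of the leg [hi], and the iterated
   coproduct [h1 \ox h2 \ox h3 \ox h4] is bracketed to the left. *)
Record weak_matched_pair : Prop := WeakMatchedPair {
  wmp_module : left_module_algebra act;
  wmp_comodule : right_comodule_coalgebra (wb_coalg H) rho;
  wmp_compat : forall (h g : H) (x : A),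
    \tsum_(h1 \ox h2 <- comul h)
      \tsum_(u \ox a <- rho (h2 * g)) \tsum_(y1 \ox y2 <- comul (h1 |> x))
        (u \ox y1 \ox (y2 * a))
    = \tsum_(h123 \ox h4 <- comul h) \tsum_(h12 \ox h3 <- comul h123)
      \tsum_(h1 \ox h2 <- comul h12)
        \tsum_(h10 \ox h11 <- rho h1) \tsum_(h30 \ox h31 <- rho h3)
        \tsum_(g0 \ox g1 <- rho g) \tsum_(x1 \ox x2 <- comul x)
          ((h30 * g0) \ox (h10 |> x1)
             \ox (h11 * (h2 |> x2) * h31 * (h4 |> g1)));
  wmp_counit_s : forall (h : H) (x : A),
    counit_s (h |> x) = counit_s (h |> 1) * counit_s x;
  wmp_coact1 :
    \tsum_(e1 \ox e2 <- comul (1 : H)) (rho e1 \ox e2)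
    = \tsum_(e1 \ox e2 <- comul (1 : H)) \tsum_(f1 \ox f2 <- comul (1 : H))
      (e1 \ox (\tsum_(f10 \ox f11 <- rho f1) (counit f10 *: f11)) \ox (e2 * f2))
}.

Definition cocommutative : Prop :=
  forall h : H, comul h = \tsum_(h1 \ox h2 <- comul h) (h2 \ox h1).

Record abelian_weak_matched_pair : Prop := AbelianWeakMatchedPair {
  awmp_weak_matched_pair : weak_matched_pair;
  awmp_cocommutative : cocommutative;
  awmp_commutative : commutative (@GRing.mul A)
}.

Record compatible_weak_matched_pair : Prop := CompatibleWeakMatchedPair {
  cwmp_abelian : abelian_weak_matched_pair;
  cwmp_act1 : forall h : H,
    h |> 1 = \tsum_(h1 \ox h2 <- comul h) \tsum_(e1 \ox e2 <- comul (1 : A))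
      (counit (h2 |> e2) *: (h1 |> e1));
  cwmp_act_comul1 : forall h g : H,
    \tsum_(e1 \ox e2 <- comul (1 : A)) ((h |> e1) \ox (g |> e2))
    = \tsum_(e1 \ox e2 <- comul (1 : A))
      (((h |> 1) * e1) \ox ((g |> 1) * e2))
}.

End MatchedPair.

(* Main.v *)
(** Since [H] is cocommutative and [A] commutative, the antipode of [H] gives
    [a (h . b) = h_1 . ((S(h_2) . a) b)].  With [b = alpha] an integral, the right
    side only depends on [eps_t(S(h_2) . a)].  The compatibility conditions
    yield [eps_t(g . a) = eps_t((g . 1) a)] and [g . eps_t(a) = (g . 1) eps_t(a)],
    so [a] may be replaced by [eps_t(a)] there, and the same formula read
    backwards turns the result into [eps_t(a) (h . alpha)]. *)

Require Import Defs.
From mathcomp Require Import all_boot all_algebra.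

Set Implicit Arguments.
Unset Strict Implicit.
Unset Printing Implicit Defensive.

Import GRing.Theory.

Local Open Scope ring_scope.

Section TensorSums.
Context {K : fieldType}.
Implicit Types U V W X : lmodType K.

Lemma eq_tsum (U : nmodType) V W (t : (V \ox W)%type) (E F : V -> W -> U) :
  (forall x y, E x y = F x y) -> tsum t E = tsum t F.
Proof. by move=> EF; apply: eq_bigr. Qed.

Lemma exchange_tsum (U : nmodType) V W V' W'
    (t : (V \ox W)%type) (s : (V' \ox W')%type) (E : V -> W -> V' -> W' -> U) :
  \tsum_(x \ox y <- t) \tsum_(x' \ox y' <- s) E x y x' y'
  = \tsum_(x' \ox y' <- s) \tsum_(x \ox y <- t) E x y x' y'.
Proof. exact: exchange_big. Qed.

Lemma linear_tsum U U' V W (f : U -> U') (t : (V \ox W)%type) (E : V -> W -> U) :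
  linear f -> f (tsum t E) = \tsum_(x \ox y <- t) f (E x y).
Proof.
move=> fl; have fD : {morph f : x y / x + y}.
  by move=> x y; have := fl 1 x y; rewrite !scale1r.
by apply: (big_morph f fD); apply: (@addrI _ (f 0)); rewrite -fD !addr0.
Qed.

Lemma linear_scale U U' (f : U -> U') c x : linear f -> f (c *: x) = c *: f x.
Proof.
move=> fl; have f0 : f 0 = 0.
  by apply: (@addrI _ (f 0)); have := fl 1 0 0; rewrite !scale1r !addr0.
by have := fl c x 0; rewrite f0 !addr0.
Qed.

Lemma tsum_linear_term U V W X (t : (V \ox W)%type) (E : X -> V -> W -> U) :
  (forall x y, linear (fun z => E z x y)) -> linear (fun z => tsum t (E z)).
Proof.
move=> El c u v; rewrite /tsum scaler_sumr -big_split.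
by apply: eq_bigr => p _; rewrite El.
Qed.

Lemma tsum_bind U V W V' W' (t : (V \ox W)%type) (s : V -> W -> (V' \ox W')%type)
    (F : V' -> W' -> U) :
    (forall w, linear (F^~ w)) -> (forall v, linear (F v)) ->
  tsum (\tsum_(x \ox y <- t) s x y) F = \tsum_(x \ox y <- t) tsum (s x y) F.
Proof. by move=> Fl Fr; apply: (linear_tsum _ _ (tsum_linear Fl Fr)). Qed.

Section Trilinear.
Context {U V W X : lmodType K} (F : V -> W -> X -> U).
Hypotheses (F1 : forall y z, linear (fun x => F x y z))
  (F2 : forall x z, linear (fun y => F x y z)) (F3 : forall x y, linear (F x y)).

(** The linear map on the triple tensor product induced by a trilinear [F]. Applying it to both
    sides of an axiom stated in that product yields a rewriting rule for Sweedler sums. *)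
Definition tsum3 (t : (V \ox W \ox X)%type) : U :=
  \tsum_(u \ox z <- t) \tsum_(x \ox y <- u) F x y z.

Let tsum3_l z : linear (fun u => \tsum_(x \ox y <- u) F x y z).
Proof. by apply: tsum_linear => ?; [apply: F1 | apply: F2]. Qed.

Let tsum3_r u : linear (fun z => \tsum_(x \ox y <- u) F x y z).
Proof. by apply: tsum_linear_term => x y; apply: F3. Qed.

Lemma tsum3_linear : linear tsum3.
Proof. exact: tsum_linear tsum3_l tsum3_r. Qed.

Lemma tsum3_tens x y z : tsum3 (x \ox y \ox z) = F x y z.
Proof.
by rewrite /tsum3 (tsum_tens tsum3_l tsum3_r) tsum_tens.
Qed.

End Trilinear.

End TensorSums.

(** Discharges the linearity conditions of such rules. The final rewrite moves the scalar [c] past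
    another coefficient, typically a value of the counit. *)
Ltac multilinear :=
  repeat match goal with |- forall _, _ => intro end;
  let c := fresh in let u := fresh in let v := fresh in
  move=> c u v /=;
  rewrite ?(tens_linearl, tens_linearr, linearP, mulrDl, mulrDr, scalerDl,
    scalerDr, =^~ alg_scalerAl, =^~ alg_scalerAr, =^~ scalerA);
  rewrite -?scalerA //; try by rewrite !scalerA [c * _]mulrC.

Section WeakBialgebraTheory.
Context {K : fieldType} {H : weakBialgType K}.
Implicit Types h k : H.

Lemma comulA_tsum (U : lmodType K) (F : H -> H -> H -> U) h :
    (forall y z, linear (fun x => F x y z)) ->
    (forall x z, linear (fun y => F x y z)) -> (forall x y, linear (F x y)) ->
  \tsum_(x \ox h3 <- comul h) \tsum_(h1 \ox h2 <- comul x) F h1 h2 h3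
  = \tsum_(h1 \ox x <- comul h) \tsum_(h2 \ox h3 <- comul x) F h1 h2 h3.
Proof.
move=> F1 F2 F3; have := congr1 (tsum3 F) (coalg_comulA (wb_coalg H) h).
rewrite !(linear_tsum _ _ (tsum3_linear F1 F2 F3)).
under eq_tsum => x y do rewrite (linear_tsum _ _ (tsum3_linear F1 F2 F3)).
under [in RHS]eq_tsum => x y do rewrite (linear_tsum _ _ (tsum3_linear F1 F2 F3)).
under eq_tsum => x y do under eq_tsum => x' y' do rewrite tsum3_tens //.
by under [in RHS]eq_tsum => x y do under eq_tsum => x' y' do rewrite tsum3_tens //.
Qed.

Lemma comul1l_tsum (U : lmodType K) (F : H -> H -> H -> U) :
    (forall y z, linear (fun x => F x y z)) ->
    (forall x z, linear (fun y => F x y z)) -> (forall x y, linear (F x y)) ->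
  \tsum_(x \ox x3 <- comul (1 : H)) \tsum_(x1 \ox x2 <- comul x) F x1 x2 x3
  = \tsum_(y1 \ox y2 <- comul (1 : H)) \tsum_(x1 \ox x2 <- comul (1 : H))
      F x1 (y1 * x2) y2.
Proof.
move=> F1 F2 F3; have := congr1 (tsum3 F) (wb_comul1l H).
rewrite !(linear_tsum _ _ (tsum3_linear F1 F2 F3)).
under eq_tsum => x y do rewrite (linear_tsum _ _ (tsum3_linear F1 F2 F3)).
under [in RHS]eq_tsum => x y do rewrite (linear_tsum _ _ (tsum3_linear F1 F2 F3)).
under eq_tsum => x y do under eq_tsum => x' y' do
  rewrite tsum3_tens // mul1r mulr1.
by under [in RHS]eq_tsum => x y do under eq_tsum => x' y' do rewrite tsum3_tens //.
Qed.

(** By coassociativity the left side is [eps(1_1 h) 1_2 (x) 1_3]. The factorization of [Delta^2(1)]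
    with [1_2 = 1'_1 1_2] then lets the sum over the unprimed copy reassemble [eps_t(h)]. *)
Lemma comul_counit_t h :
  comul (counit_t h) = \tsum_(e1 \ox e2 <- comul (1 : H)) ((e1 * counit_t h) \ox e2).
Proof.
rewrite [counit_t h in LHS]/counit_t (linear_tsum _ _ (@linearP _ _ _ _ comul)).
transitivity (\tsum_(e1 \ox x <- comul (1 : H)) \tsum_(e2 \ox e3 <- comul x)
   (counit (e1 * h) *: (e2 \ox e3 : (H \ox H)%type))).
  apply: eq_tsum => e1 x; rewrite linearZ /= {1}(tens_decomp (comul x)).
  by apply: (@linear_tsum _ _ _ _ _ ( *:%R (counit (e1 * h)))); multilinear.
rewrite -comulA_tsum; [|by multilinear..].
rewrite comul1l_tsum; [|by multilinear..].
apply: eq_tsum => y1 y2; rewrite /counit_t.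
rewrite (@linear_tsum _ _ (H \ox H)%type _ _ (fun x : H => (y1 * x) \ox y2)).
  apply: eq_tsum => e1 e2; rewrite -alg_scalerAr.
  by rewrite (@linear_scale _ _ _ (fun x : H => x \ox y2)) //; multilinear.
by multilinear.
Qed.

(** This is the second weak multiplicativity axiom of the counit, applied to [h * 1 * k]. *)
Lemma counit_counit_s h k : counit (counit_s h * k) = counit (h * k).
Proof.
rewrite -{2}[h]mulr1 [RHS]wb_counitM21 /counit_s.
rewrite (@linear_tsum _ _ K^o _ _ (fun x : H => counit (x * k))); last by multilinear.
by apply: eq_tsum => e1 e2; rewrite -alg_scalerAl linearZ.
Qed.

Lemma cocommutative_tsum (U : lmodType K) (F : H -> H -> U) h :
    @cocommutative K H ->
    (forall k, linear (F^~ k)) -> (forall g, linear (F g)) ->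
  \tsum_(h1 \ox h2 <- comul h) F h1 h2 = \tsum_(h1 \ox h2 <- comul h) F h2 h1.
Proof.
move=> coH F1 F2; rewrite [in LHS]coH tsum_bind //.
by apply: eq_tsum => h1 h2; rewrite tsum_tens.
Qed.

End WeakBialgebraTheory.

Section ModuleAlgebraTheory.
Context {K : fieldType} {H : weakHopfType K} {A : algebraType K}.
Variable act : {linear (H \ox A)%type -> A}.
Hypothesis modA : left_module_algebra act.
Local Notation "h |> a" := (act (@tens K H A h a)) (at level 35).
Local Notation S := (@antipode K H).
Implicit Types (g h : H) (a y : A).

(** Expand the left side as an action on [1 * y] and the right side as [1_H] acting on the product;
    [comul_counit_t] makes the two sums agree. *)
Lemma counit_t_act h y : counit_t h |> y = (counit_t h |> 1) * y.
Proof.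
rewrite -[RHS](act1 modA) (actM modA) -[y in LHS]mul1r (actM modA).
rewrite comul_counit_t tsum_bind; [|by multilinear..].
apply: eq_tsum => e1 e2; rewrite tsum_tens; [|by multilinear..].
by rewrite (actA modA).
Qed.

Hypotheses (coH : @cocommutative K H) (mulAC : commutative (@GRing.mul A)).

Lemma mul_act g y a :
  y * (g |> a) = \tsum_(g1 \ox g2 <- comul g) (g1 |> ((S g2 |> y) * a)).
Proof.
(* Bracketed to the right, [h_2 S(h_3)] becomes [eps_t], whose action on [y] is multiplication by
   [h_2 . 1], and this factor is absorbed by [h_1 . a]. Bracketed to the left, cocommutativity swaps
   [h_1] and [h_2], so that the action of [h_1 (x) h_2] on a product can be folded. *)
pose F h1 h2 h3 : A := ((h2 * S h3) |> y) * (h1 |> a).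
transitivity (\tsum_(x \ox h3 <- comul g) \tsum_(h1 \ox h2 <- comul x) F h1 h2 h3).
  rewrite comulA_tsum /F; [|by multilinear..].
  transitivity (\tsum_(h1 \ox x <- comul g) ((h1 |> a) * (counit_t x |> y))).
    rewrite -[a in LHS]mulr1 (actM modA) mulAC.
    rewrite (@linear_tsum _ _ _ _ _ (fun z : A => z * y)); last by multilinear.
    by apply: eq_tsum => h1 x; rewrite -mulrA (act_unit modA) -counit_t_act.
  apply: eq_tsum => h1 x; rewrite mulAC -antipode_t.
  by rewrite (@linear_tsum _ _ _ _ _ (fun z : H => (z |> y) * (h1 |> a))); last by multilinear.
apply: eq_tsum => g1 g2; rewrite (actM modA) cocommutative_tsum /F //; [|by multilinear..].
by apply: eq_tsum => h1 h2; rewrite (actA modA).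
Qed.

End ModuleAlgebraTheory.

Section MatchedPairTheory.
Context {K : fieldType} {H : weakHopfType K} {A : weakBialgType K}.
Variables (act : {linear (H \ox A)%type -> A}).
Variables (rho : {linear H -> (H \ox A)%type}).
Hypothesis HA : compatible_weak_matched_pair act rho.
Local Notation "h |> a" := (act (@tens K H A h a)) (at level 35).
Local Notation S := (@antipode K H).
Implicit Types (g h k : H) (a x y : A).

Let wmp := awmp_weak_matched_pair (cwmp_abelian HA).
Let modA := wmp_module wmp.
Let mulAC : commutative (@GRing.mul A) := awmp_commutative (cwmp_abelian HA).
Let mul_actE := mul_act modA (awmp_cocommutative (cwmp_abelian HA)) mulAC.

(** Inside [counit] a factor may be replaced by its [eps_s]. Since
    [eps_s(h . x) = eps_s(h . 1) eps_s(x)], commutativity allows both [eps_s] to be removed in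
    turn. *)
Lemma counit_act h x : counit (h |> x) = counit ((h |> 1) * x).
Proof.
rewrite -[h |> x]mulr1 -counit_counit_s (wmp_counit_s wmp) mulr1.
by rewrite mulAC counit_counit_s mulAC counit_counit_s.
Qed.

(** The second compatibility condition with [1_H] acting on the other leg, evaluated on a bilinear
    [F]. *)
Lemma act_comul1l (U : lmodType K) (F : A -> A -> U) g :
    (forall y, linear (F^~ y)) -> (forall x, linear (F x)) ->
  \tsum_(e1 \ox e2 <- comul (1 : A)) F (g |> e1) e2
  = \tsum_(e1 \ox e2 <- comul (1 : A)) F ((g |> 1) * e1) e2.
Proof.
move=> F1 F2; have := congr1 (fun t => tsum t F) (cwmp_act_comul1 HA g 1).
rewrite /= !tsum_bind //.
under eq_tsum => e1 e2 do rewrite tsum_tens // (act1 modA).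
by under [in RHS]eq_tsum => e1 e2 do rewrite tsum_tens // (act1 modA) mul1r.
Qed.

Lemma act_comul1r (U : lmodType K) (F : A -> A -> U) g :
    (forall y, linear (F^~ y)) -> (forall x, linear (F x)) ->
  \tsum_(e1 \ox e2 <- comul (1 : A)) F e1 (g |> e2)
  = \tsum_(e1 \ox e2 <- comul (1 : A)) F e1 ((g |> 1) * e2).
Proof.
move=> F1 F2; have := congr1 (fun t => tsum t F) (cwmp_act_comul1 HA 1 g).
rewrite /= !tsum_bind //.
under eq_tsum => e1 e2 do rewrite tsum_tens // (act1 modA).
by under [in RHS]eq_tsum => e1 e2 do rewrite tsum_tens // (act1 modA) mul1r.
Qed.

(** [eps_t(x)] is a combination of second legs of [Delta(1)], on which [g] acts as multiplication by
    [g . 1]. *)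
Lemma act_counit_t g x : g |> counit_t x = (g |> 1) * counit_t x.
Proof.
rewrite /counit_t.
rewrite (@linear_tsum _ _ _ _ _ (fun z => g |> z)); last by multilinear.
rewrite (@linear_tsum _ _ _ _ _ (fun z : A => (g |> 1) * z)); last by multilinear.
transitivity (\tsum_(e1 \ox e2 <- comul (1 : A)) (counit (e1 * x) *: (g |> e2))).
  by apply: eq_tsum => e1 e2; rewrite (@linear_scale _ _ _ (fun z => g |> z)) //; multilinear.
rewrite (act_comul1r (F := fun e1 e2 => counit (e1 * x) *: e2)); [|by multilinear..].
by apply: eq_tsum => e1 e2; rewrite -alg_scalerAr.
Qed.

(** In [eps(e_1 (g . a)) e_2] the leg [e_1] stands outside the action, so [counit_act] does not
    apply at once. [mul_act] brings it inside as [S(g_2) . e_1], compatibility turns this into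
    [(S(g_2) . 1) e_1], and folding back leaves [eps(g . (e_1 a)) e_2]. *)
Lemma counit_t_actE g a : counit_t (g |> a) = counit_t ((g |> 1) * a).
Proof.
transitivity (\tsum_(g1 \ox g2 <- comul g) \tsum_(e1 \ox e2 <- comul (1 : A))
  (counit (g1 |> ((S g2 |> e1) * a)) *: e2)).
  rewrite exchange_tsum; apply: eq_tsum => e1 e2; rewrite mul_actE.
  by rewrite (@linear_tsum _ _ _ _ _ (fun z : A => counit z *: e2)); last by multilinear.
transitivity (\tsum_(g1 \ox g2 <- comul g) \tsum_(e1 \ox e2 <- comul (1 : A))
  (counit (g1 |> ((S g2 |> 1) * (e1 * a))) *: e2)).
  apply: eq_tsum => g1 g2.
  rewrite (act_comul1l (F := fun e1 e2 => counit (g1 |> (e1 * a)) *: e2)); [|by multilinear..].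
  by apply: eq_tsum => e1 e2; rewrite mulrA.
rewrite exchange_tsum; apply: eq_tsum => e1 e2.
(* [mul_actE] with left factor [1] refolds the sum over [g]. *)
transitivity (counit (1 * (g |> (e1 * a))) *: e2).
  rewrite mul_actE.
  by rewrite (@linear_tsum _ _ _ _ _ (fun z : A => counit z *: e2)); last by multilinear.
by rewrite mul1r counit_act !mulrA [_ * e1]mulAC.
Qed.

End MatchedPairTheory.

Theorem lemma5p9 (K : fieldType) (H A : weakHopfType K)
    (act : {linear (H \ox A)%type -> A}) (rho : {linear H -> (H \ox A)%type})
    (HA : compatible_weak_matched_pair act rho) (alpha : A)
    (Halpha : left_integral alpha) :
  forall h : H, left_integral (act (h \ox alpha)).
Proof.
have [ab _ _] := HA; have [wmp coH mulAC] := ab.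
move=> h a; rewrite !(mul_act (wmp_module wmp) coH mulAC); apply: eq_tsum => h1 h2.
(* Termwise, both arguments of [h_1] become [(S(h_2) . 1) eps_t(a) alpha]: on the left [a] leaves
   the action under [eps_t], which the integral property inserts and removes; on the right
   [act_counit_t] suffices. *)
by rewrite Halpha (counit_t_actE HA) -Halpha (act_counit_t HA) -!mulrA Halpha.
Qed.
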